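(* Let $\mathbb K$ be a field, $R=\mathbb K[x_0,\dots,x_n]$, let $J\subset R$ be a quasi-stable monomial ideal with $\dim(R/J)>0$, and let $\rho$ be the satiety of the ideal $(J^{sat},x_0)/(x_0)\subset\mathbb K[x_1,\dots,x_n]$. Let $I\subset R$ be a homogeneous ideal and let $m\ge\rho$ be an integer such that $J=(J^{sat})_{\ge m-1}$, $I=(I^{sat})_{\ge m-1}$, and $I$ is generated by a $\mathcal P_J$-marked basis $\mathcal H$. Let $\mathcal H_0=\{h_{\alpha_1},\dots,h_{\alpha_r}\}\subseteq\mathcal H$ be the set of the marked polynomials in $\mathcal H$ whose head term is divisible by $x_0$. For every $h_{\alpha_i}\in\mathcal H_0$ and $k\geq 1$, let $h_{\alpha_i}=h'_{\alpha_i,k}+h''_{\alpha_i,k}$ be the decomposition such that all terms in $h'_{\alpha_i,k}$ are divisible by $x_0^k$ and no term in $h''_{\alpha_i,k}$ is divisible by $x_0^k$. Let $\mathcal S$ be the set of all polynomials $$\sum_{i} c_{\alpha_i,k}\,\frac{h'_{\alpha_i,k}}{x_0^k},$$ where $k\in\{1,\dots,m-2\}$, the sum runs over the indices $i\in\{1,\dots,r\}$ such that $x_0^k$ divides the head term of $h_{\alpha_i}$, the $c_{\alpha_i,k}\in\mathbb K$, and $\sum_i c_{\alpha_i,k}h''_{\alpha_i,k}=0$ (sum over the same indices). Then there is the graded decomposition of $\mathbb K$-vector spaces $$(I:x_0^\infty)=I\oplus\langle\mathcal S\rangle_{\mathbb K}.$$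
   Context: $R=\mathbb K[x_0,\dots,x_n]$ has the standard grading and variables ordered $x_0<x_1<\dots<x_n$. A term is a monomial $x^\alpha=x_0^{\alpha_0}\cdots x_n^{\alpha_n}$; for $x^\alpha\neq 1$, $\min(x^\alpha)$ (resp. $\max(x^\alpha)$) is the smallest (resp. largest) variable dividing $x^\alpha$. A monomial ideal $J$ is quasi-stable if for every term $x^\tau\in J$ and every variable $x_k>\min(x^\tau)$ there is an exponent $s_k$ with $\frac{x^\tau}{\min(x^\tau)}x_k^{s_k}\in J$. This holds if and only if $J$ has a (unique) Pommaret basis $\mathcal P_J$: a finite set of terms generating $J$ such that for every term $x^\tau\in J\setminus\mathcal P_J$ there is a unique $x^\sigma\in\mathcal P_J$ with $x^\tau=x^\delta x^\sigma$ and $\max(x^\delta)\le\min(x^\sigma)$. $\mathcal N(J)$ is the set of terms not in $J$, and $\mathcal N(J)_t$ its subset of terms of degree $t$. A $\mathcal P_J$-marked set is a set $\mathcal H=\{h_\alpha\}_{x^\alpha\in\mathcal P_J}\subset R$ of homogeneous polynomials, one for each $x^\alpha\in\mathcal P_J$, such that $x^\alpha$ (the head term of $h_\alpha$) occurs in $h_\alpha$ with coefficient $1$ and all other terms occurring in $h_\alpha$ belong to $\mathcal N(J)$. It is a $\mathcal P_J$-marked basis if $R_t=(\mathcal H)_t\oplus\langle\mathcal N(J)_t\rangle_{\mathbb K}$ for every degree $t$. For a homogeneous ideal $I$: $I_{\ge t}$ is the ideal generated by the homogeneous elements of $I$ of degree $\ge t$; $I^{sat}=\{f : \forall i\ \exists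 k_i,\ x_i^{k_i}f\in I\}$ is the saturation; the satiety of $I$ is the minimum integer $s$ such that $I_t=(I^{sat})_t$ for all $t\ge s$. $(I:x_0^\infty)=\{f\in R: x_0^kf\in I\text{ for some }k\ge 0\}$. *)

(* Defs.v *)
From mathcomp Require Import all_boot all_algebra finmap.
From mathcomp Require Import mpoly.

Set Implicit Arguments.
Unset Strict Implicit.
Unset Printing Implicit Defensive.

Import GRing.Theory.
Local Open Scope ring_scope.

(* Ideals and subspaces are Prop-valued predicates: the boolean ideals of
   ring_quotient are decidable and proper by definition, which fits neither
   saturations nor colon ideals. *)

Definition eq_set (T : Type) (A B : T -> Prop) : Prop := forall x, A x <-> B x.

Section RingIdeals.
Variable A : comNzRingType.
Implicit Types I J S : A -> Prop.

Definition is_ideal I : Prop :=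
  [/\ I 0, (forall f g, I f -> I g -> I (f + g))
         & forall a f, I f -> I (a * f)].

Definition gen_ideal S : A -> Prop := fun f =>
  exists (k : nat) (a b : 'I_k -> A),
    (forall i, S (b i)) /\ f = \sum_(i < k) a i * b i.

Definition is_prime_ideal I : Prop :=
  [/\ is_ideal I, ~ I 1 & forall f g, I (f * g) -> I f \/ I g].

Definition proper_subset I J : Prop :=
  (forall f, I f -> J f) /\ exists2 f, J f & ~ I f.

(* [dim (A / I) > d]; primes of A / I are the primes of A containing I. *)
Definition krull_dim_quot_gt I (d : nat) : Prop :=
  exists (l : nat) (c : nat -> A -> Prop),
    [/\ (d < l)%N,
        (forall i, (i <= l)%N ->
           is_prime_ideal (c i) /\ forall f, I f -> c i f)
      & forall i, (i < l)%N -> proper_subset (c i) (c i.+1)].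

End RingIdeals.

Section Subspaces.
Variables (K : fieldType) (V : lmodType K).
Implicit Types A B C S : V -> Prop.

Definition is_subspace A : Prop :=
  [/\ A 0, (forall f g, A f -> A g -> A (f + g))
         & forall c f, A f -> A (c *: f)].

Definition linear_span S : V -> Prop := fun f =>
  exists (k : nat) (c : 'I_k -> K) (b : 'I_k -> V),
    (forall i, S (b i)) /\ f = \sum_(i < k) c i *: b i.

Definition direct_sum C A B : Prop :=
  eq_set C (fun f => exists g h, [/\ A g, B h & f = g + h]) /\
  forall f, A f -> B f -> f = 0.

End Subspaces.

Section Graded.
Variables (K : fieldType) (n : nat).
Local Notation R := {mpoly K[n]}.
Implicit Types A B C I : R -> Prop.

Definition is_graded A : Prop :=
  forall f t, A f -> A (pihomog mdeg t f).

Definition is_graded_subspace A : Prop := is_subspace A /\ is_graded A.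

Definition is_homogeneous_ideal I : Prop := is_ideal I /\ is_graded I.

Definition graded_piece A (t : nat) : R -> Prop :=
  fun f => A f /\ f \is t.-homog.

Definition graded_direct_sum C A B : Prop :=
  [/\ is_graded_subspace C, is_graded_subspace A, is_graded_subspace B
    & direct_sum C A B].

Definition truncation I (t : nat) : R -> Prop :=
  gen_ideal (fun f => I f /\ exists2 d, (t <= d)%N & f \is d.-homog).

Definition saturation I : R -> Prop :=
  fun f => forall i : 'I_n, exists k : nat, I ('X_i ^+ k * f).

Definition saturated_from I (s : nat) : Prop :=
  forall t, (s <= t)%N ->
    eq_set (graded_piece I t) (graded_piece (saturation I) t).

Definition is_satiety I (s : nat) : Prop :=
  saturated_from I s /\ forall s', saturated_from I s' -> (s <= s')%N.

Definition terms (M : 'X_{1..n} -> Prop) : R -> Prop :=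
  fun f => exists2 m, M m & f = 'X_[m].

Definition is_monomial_ideal I : Prop :=
  exists M, eq_set I (gen_ideal (terms M)).

End Graded.

Section Pommaret.
Variables (K : fieldType) (n : nat).
Local Notation R := {mpoly K[n]}.
Implicit Types (J : R -> Prop) (m : 'X_{1..n}) (P : {fset 'X_{1..n}}).

(* 'X_i is the smallest (largest) variable dividing 'X_[m]; no i qualifies
   when m = 0, i.e. for the term 1. *)
Definition is_minvar m (i : 'I_n) : Prop :=
  (0 < m i)%N /\ forall j : 'I_n, (0 < m j)%N -> (i <= j)%N.

Definition is_maxvar m (i : 'I_n) : Prop :=
  (0 < m i)%N /\ forall j : 'I_n, (0 < m j)%N -> (j <= i)%N.

Definition quasi_stable J : Prop :=
  is_monomial_ideal J /\
  forall m (i k : 'I_n), J 'X_[m] -> is_minvar m i -> (i < k)%N ->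
    exists s : nat, J 'X_[m - U_(i) + U_(k) *+ s].

Definition pommaret_divides (s t : 'X_{1..n}) : Prop :=
  exists d : 'X_{1..n}, t = (d + s)%MM /\
    forall i j : 'I_n, is_maxvar d i -> is_minvar s j -> (i <= j)%N.

Definition is_pommaret_basis J P : Prop :=
  eq_set J (gen_ideal (terms (fun m => m \in P))) /\
  forall t, J 'X_[t] -> t \notin P ->
    exists! s, s \in P /\ pommaret_divides s t.

Definition normal_term J m : Prop := ~ J 'X_[m].

(* [h a] is the marked polynomial with head term 'X_[a], for a \in P; the
   values of h outside P are irrelevant. *)
Definition marked_polys P (h : 'X_{1..n} -> R) : R -> Prop :=
  fun f => exists2 a, a \in P & f = h a.

Definition is_marked_set J P (h : 'X_{1..n} -> R) : Prop :=
  forall a, a \in P ->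
    [/\ h a \is homog mdeg, (h a)@_a = 1
      & forall b, b \in msupp (h a) -> b != a -> normal_term J b].

Definition is_marked_basis J P (h : 'X_{1..n} -> R) : Prop :=
  is_marked_set J P h /\
  forall t : nat,
    direct_sum (fun f : R => f \is t.-homog)
      (graded_piece (gen_ideal (marked_polys P h)) t)
      (linear_span (terms (fun m => normal_term J m /\ mdeg m = t))).

End Pommaret.

Section FirstVariable.
Variables (K : fieldType) (n : nat).
Local Notation R := {mpoly K[n.+1]}.
Implicit Types (I : R -> Prop) (p : R).

Definition colon_x0_inf I : R -> Prop :=
  fun f => exists k : nat, I ('X_ord0 ^+ k * f).

Definition add_x0 I : R -> Prop := gen_ideal (fun f => I f \/ f = 'X_ord0).

(* The projection R -> R / (x_0) = K[x_1, ..., x_n], where x_(i+1) is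
   renumbered as the i-th variable of {mpoly K[n]}. *)
Definition mod_x0 p : {mpoly K[n]} :=
  p \mPo [tuple (if unlift ord0 i is Some j then 'X_j else 0) | i < n.+1].

Definition image_mod_x0 I : {mpoly K[n]} -> Prop :=
  fun g => exists2 f, I f & g = mod_x0 f.

(* h' and h'' : the terms divisible, resp. not divisible, by x_0^k. *)
Definition x0_part (k : nat) p : R :=
  \sum_(m <- msupp p | (k <= m ord0)%N) p@_m *: 'X_[m].

Definition x0_rest (k : nat) p : R :=
  \sum_(m <- msupp p | ~~ (k <= m ord0)%N) p@_m *: 'X_[m].

(* Termwise division by x_0^k. The difference of exponents is truncated, so
   this is the quotient only when x_0^k divides every term of p. *)
Definition x0_quot (k : nat) p : R :=
  \sum_(m <- msupp p) p@_m *: 'X_[m - U_(ord0) *+ k].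

Lemma x0_part_rest k p : p = x0_part k p + x0_rest k p.
Proof.
by rewrite {1}[p]mpolyE (bigID (fun m : 'X_{1..n.+1} => (k <= m ord0)%N)).
Qed.

Lemma mcoeff_x0_part k p m :
  (x0_part k p)@_m = if (k <= m ord0)%N then p@_m else 0.
Proof.
rewrite [in RHS](x0_part_rest k p) mcoeffD /x0_part /x0_rest !raddf_sum /=.
case: leqP => km; last first.
  by rewrite big1 // => i ki; rewrite mcoeffZ mcoeffX;
     case: (i =P m) ki => [->|_ _]; rewrite ?mulr0 // leqNgt km.
rewrite [X in _ = _ + X]big1 ?addr0 // => i ki; rewrite mcoeffZ mcoeffX.
by case: (i =P m) ki => [->|_ _]; rewrite ?mulr0 // km.
Qed.

Lemma x0_quot_part k p :
  x0_quot k (x0_part k p) * 'X_ord0 ^+ k = x0_part k p.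
Proof.
rewrite {2}[x0_part k p]mpolyE /x0_quot mulr_suml.
rewrite big_seq [RHS]big_seq; apply: eq_bigr => m; rewrite mcoeff_msupp.
rewrite mcoeff_x0_part; case: leqP => [km _|]; last by rewrite eqxx.
rewrite -scalerAl mpolyXn -mpolyXD; congr (_ *: 'X_[_]).
apply/mnmP => i; rewrite !mnmE !mulmnE !mnm1E.
by case: (ord0 =P i) => [<-|_]; rewrite ?mul1n ?mul0n ?subn0 ?addn0 ?subnK.
Qed.

Definition divisible_heads (P : {fset 'X_{1..n.+1}}) : {fset 'X_{1..n.+1}} :=
  [fset a in P | (0 < a ord0)%N]%fset.

Definition syzygy_quotients (P : {fset 'X_{1..n.+1}})
    (h : 'X_{1..n.+1} -> R) (m : nat) : R -> Prop := fun f =>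
  exists (k : nat) (c : 'X_{1..n.+1} -> K),
    [/\ (1 <= k <= m - 2)%N,
        \sum_(a <- divisible_heads P | (k <= a ord0)%N)
           c a *: x0_rest k (h a) = 0
      & f = \sum_(a <- divisible_heads P | (k <= a ord0)%N)
           c a *: x0_quot k (x0_part k (h a))].

End FirstVariable.

(* Main.v *)
Require Import Defs.
From HB Require Import structures.
From mathcomp Require Import all_boot all_algebra finmap.
From mathcomp Require Import mpoly.

(* Put d = m - 1. Since J is quasi-stable and saturated in degrees >= d, a normal
   term of degree >= d remains normal after multiplication by powers of x_0;
   reducing modulo the marked basis then shows that (I : x_0^oo) and I agree in
   degrees >= d. In degree t < d, f lies in (I : x_0^oo) iff x_0^(d-t) f lies in
   I_d, hence is a combination of the h_a with deg a = d. The coefficient of h_a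
   is the coefficient of the term a in x_0^(d-t) f, because all other h_b only
   have normal terms there; so only heads divisible by x_0^(d-t) contribute, and
   splitting every h_a gives the elements of S. Conversely all heads divisible by
   x_0 have degree exactly d, so S lives in degrees < d while I lives in degrees
   >= d. Finally t = 0 is impossible because x_0^d in J would force
   dim (R / J) = 0. *)

Set Implicit Arguments.
Unset Strict Implicit.
Unset Printing Implicit Defensive.

Import GRing.Theory.
Local Open Scope ring_scope.

(** * Closure properties of generated ideals and linear spans *)

Section Closure.

Lemma sum_splice (V : nmodType) (T : Type) k1 k2 (F : T -> V)
    (b1 : 'I_k1 -> T) (b2 : 'I_k2 -> T) :
  \sum_(i < k1 + k2)
    F (match split i with inl j => b1 j | inr j => b2 j end) =
  \sum_(i < k1) F (b1 i) + \sum_(i < k2) F (b2 i).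
Proof.
rewrite big_split_ord; congr (_ + _); apply: eq_bigr => i _.
  by rewrite (unsplitK (inl i)).
by rewrite (unsplitK (inr i)).
Qed.

Lemma gen_ideal_is_ideal (A : comNzRingType) (S : A -> Prop) :
  is_ideal (gen_ideal S).
Proof.
split.
- by exists 0%N, (fun=> 0), (fun=> 0); split; [case | rewrite big_ord0].
- move=> f g [k1 [a1 [b1 [Sb1 ->]]]] [k2 [a2 [b2 [Sb2 ->]]]].
  pose ab i := match split i with inl j => (a1 j, b1 j)
               | inr j => (a2 j, b2 j) end.
  exists (k1 + k2)%N, (fun i => (ab i).1), (fun i => (ab i).2); split.
    by move=> i; rewrite /ab; case: (split i).
  by rewrite (sum_splice (fun u => u.1 * u.2)
    (fun j => (a1 j, b1 j)) (fun j => (a2 j, b2 j))).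
- move=> c f [k [a [b [Sb ->]]]]; exists k, (fun i => c * a i), b; split=> //.
  by rewrite mulr_sumr; apply: eq_bigr => i _; rewrite mulrA.
Qed.

Lemma gen_ideal_mem (A : comNzRingType) (S : A -> Prop) f :
  S f -> gen_ideal S f.
Proof.
by move=> Sf; exists 1%N, (fun=> 1), (fun=> f); split; rewrite ?big_ord1 ?mul1r.
Qed.

Lemma eq_set_ideal (A : comNzRingType) (I I' : A -> Prop) :
  eq_set I I' -> is_ideal I' -> is_ideal I.
Proof.
move=> eI [I0 ID IM]; split; first exact/eI.
  by move=> f g /eI If /eI Ig; apply/eI/ID.
by move=> a f /eI If; apply/eI/IM.
Qed.

Variables (K : fieldType) (V : lmodType K).
Implicit Types A S : V -> Prop.

Lemma linear_span_subspace S : is_subspace (linear_span S).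
Proof.
split.
- by exists 0%N, (fun=> 0), (fun=> 0); split; [case | rewrite big_ord0].
- move=> f g [k1 [a1 [b1 [Sb1 ->]]]] [k2 [a2 [b2 [Sb2 ->]]]].
  pose ab i := match split i with inl j => (a1 j, b1 j)
               | inr j => (a2 j, b2 j) end.
  exists (k1 + k2)%N, (fun i => (ab i).1), (fun i => (ab i).2); split.
    by move=> i; rewrite /ab; case: (split i).
  by rewrite (sum_splice (fun u => u.1 *: u.2)
    (fun j => (a1 j, b1 j)) (fun j => (a2 j, b2 j))).
- move=> c f [k [a [b [Sb ->]]]]; exists k, (fun i => c * a i), b; split=> //.
  by rewrite scaler_sumr; apply: eq_bigr => i _; rewrite scalerA.
Qed.

Lemma linear_span_mem S f : S f -> linear_span S f.
Proof.
move=> Sf; exists 1%N, (fun=> 1), (fun=> f).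
by split; rewrite ?big_ord1 ?scale1r.
Qed.

Lemma subspace_sum A (T : Type) (r : seq T) (Q : pred T) (F : T -> V) :
  is_subspace A -> (forall i, Q i -> A (F i)) -> A (\sum_(i <- r | Q i) F i).
Proof. by case=> A0 AD _ AF; apply: big_ind. Qed.

Lemma linear_span_min A S :
  is_subspace A -> (forall f, S f -> A f) -> forall f, linear_span S f -> A f.
Proof.
move=> sA SA f [k [c [b [Sb ->]]]]; apply: subspace_sum => // i _.
by case: sA => _ _; apply; apply: SA.
Qed.

End Closure.

(** * Homogeneous components of products, truncations and marked polynomials *)

Section HomogeneousComponents.
Variables (K : fieldType) (n : nat).
Local Notation R := {mpoly K[n]}.
Implicit Types (p q f : R) (I A : R -> Prop) (b : 'X_{1..n}).

Lemma ideal_subspace I : is_ideal I -> is_subspace I.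
Proof. by case=> I0 ID IM; split=> // c f /(IM c%:MP); rewrite mul_mpolyC. Qed.

Lemma mcoeff_pihomog d p b :
  (pihomog mdeg d p)@_b = if mdeg b == d then p@_b else 0.
Proof.
elim/mpolyind: p => [|c m p _ _ IHp]; first by rewrite raddf0 !mcoeff0 if_same.
rewrite linearP /= pihomogX !mcoeffD {}IHp !mcoeffZ mcoeffX.
have [<-|ne_mb] := eqVneq m b.
  by case: eqP; rewrite ?mcoeffX ?eqxx ?mcoeff0 ?mulr0 ?addr0.
by case: (mdeg m == d); rewrite ?mcoeffX ?(negPf ne_mb) ?mcoeff0 !mulr0 !add0r.
Qed.

(** When [p] is split into components, only the one of degree [d - e] can contribute; for [d < e]
    there is none. *)
Lemma pihomogMr d e p q : q \is e.-homog ->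
  pihomog mdeg d (p * q) =
  if (e <= d)%N then pihomog mdeg (d - e) p * q else 0.
Proof.
move=> hq; have hom i : pihomog mdeg i p * q \is (i + e).-homog.
  by rewrite dhomogM ?pihomogP.
(* Large enough to cover all components of [p] and also the index [d - e]. *)
set k := (mmeasure mdeg p + d).+1.
have hp : p = \sum_(i < k) pihomog mdeg i p.
  by apply: pihomog_partitionE; rewrite /k -addnS leq_addr.
rewrite {1}hp mulr_suml raddf_sum /=; case: leqP => [le_ed|lt_de].
  have lt_k : (d - e < k)%N by rewrite ltnS (leq_trans (leq_subr _ _)) ?leq_addl.
  rewrite (bigD1 (Ordinal lt_k)) //= big1 ?addr0.
    by rewrite pihomog_dE // -{2}(subnK le_ed).
  move=> i ne_i; rewrite (pihomog_ne0 _ (hom i)) //.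
  apply: contraNneq ne_i => ie; apply/eqP/val_inj.
  by rewrite /= -ie addnK.
rewrite big1 // => i _; rewrite (pihomog_ne0 _ (hom i)) //.
by rewrite neq_ltn orbC (leq_trans lt_de) ?leq_addl.
Qed.

Lemma pihomog0E p : pihomog mdeg 0 p = (p@_0)%:MP.
Proof.
apply/mpolyP => b; rewrite mcoeff_pihomog mcoeffC mdeg_eq0.
by case: eqP => [->|]; rewrite ?mulr1 ?mulr0.
Qed.

Lemma graded_subspace_sum A f : is_subspace A ->
  (forall t, A (pihomog mdeg t f)) -> A f.
Proof.
move=> sA Af; rewrite (pihomog_partitionE (leqnn (mmeasure mdeg f))).
exact: subspace_sum.
Qed.

Lemma truncation_coeff I t f b :
  truncation I t f -> (mdeg b < t)%N -> f@_b = 0.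
Proof.
case=> k [a [g [hg ->]]] lt_bt; rewrite raddf_sum /= big1 // => i _.
have [_ [d le_td hom]] := hg i.
have := mcoeff_pihomog (mdeg b) (a i * g i) b; rewrite eqxx => <-.
by rewrite (pihomogMr _ _ hom) leqNgt (leq_trans lt_bt le_td) mcoeff0.
Qed.

Lemma marked_set_dhomog J P (h : 'X_{1..n} -> R) a :
  is_marked_set J P h -> a \in P -> h a \is (mdeg a).-homog.
Proof.
move=> mh aP; have [/homogP[d hd] ha _] := mh a aP.
have ah : a \in msupp (h a) by rewrite mcoeff_msupp ha oner_eq0.
by rewrite (dhomog_mf hd ah).
Qed.

End HomogeneousComponents.

(** * Quasi-stable ideals, Pommaret bases and the smallest variable *)

Section QuasiStable.
Variables (K : fieldType) (n : nat).
Local Notation R := {mpoly K[n.+1]}.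
Implicit Types (J : R -> Prop) (P : {fset 'X_{1..n.+1}}) (b s t : 'X_{1..n.+1}).

(** As long as x_0 divides a term it is the minimal variable, so quasi-stability trades one factor
    x_0 for a power of x_i; induction on [k] trades them all. *)
Lemma quasi_stable_colon_x0 J b k (i : 'I_n.+1) :
  quasi_stable J -> J 'X_[b + U_(ord0) *+ k] ->
  exists s : nat, J 'X_[b + U_(i) *+ s].
Proof.
case=> _ qJ; have [->|i0] := eqVneq i ord0; first by exists k.
elim: k b => [|k IHk] b Jb; first by exists 0%N; rewrite mulm0n in Jb *.
have min0 : is_minvar (b + U_(ord0) *+ k.+1)%MM ord0.
  by split=> // ; rewrite mnmDE mulmnE mnm1E eqxx mul1n addnS.
have [|s Js] := qJ _ _ i Jb min0; first by rewrite lt0n.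
have [|s' Js'] := IHk (b + U_(i) *+ s)%MM.
  suff -> : (b + U_(i) *+ s + U_(ord0) *+ k =
             b + U_(ord0) *+ k.+1 - U_(ord0) + U_(i) *+ s)%MM by [].
  apply/mnmP=> j; rewrite !(mnmDE, mulmnE, mnmBE, mnm1E).
  case: (ord0 == j); last by rewrite !mul0n !addn0 subn0.
  by rewrite !mul1n addnS subn1 /= -!addnA [(k + _)%N]addnC.
exists (s + s')%N; suff -> : (b + U_(i) *+ (s + s') =
  b + U_(i) *+ s + U_(i) *+ s')%MM by [].
by apply/mnmP=> j; rewrite !(mnmDE, mulmnE) mulnDr addnA.
Qed.

(** Trading x_0 for each variable in turn puts the term [b] in the saturation, and its degree puts
    it in the truncation. *)
Lemma saturated_truncation_colon J (t : nat) b k : quasi_stable J ->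
  eq_set J (truncation (saturation J) t) -> (t <= mdeg b)%N ->
  J 'X_[b + U_(ord0) *+ k] -> J 'X_[b].
Proof.
move=> qJ eJ le_tb Jb; apply/eJ/gen_ideal_mem; split; last first.
  by exists (mdeg b); rewrite ?dhomogX.
move=> i; have [s Js] := quasi_stable_colon_x0 i qJ Jb.
by exists s; rewrite mpolyXn -mpolyXD addmC.
Qed.

(** A factor x_0 can become the maximal variable of the cofactor only when the cofactor was 1, and
    x_0 is below every variable. *)
Lemma pommaret_dividesDx0 s t :
  pommaret_divides s t -> pommaret_divides s (t + U_(ord0))%MM.
Proof.
case=> d [-> hd]; exists (d + U_(ord0))%MM; split; first by
  rewrite -!addmA [(s + _)%MM]addmC.
move=> i j [di dmax] hj; have [-> //|i0] := eqVneq i ord0.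
apply: (hd) hj; split.
  by move: di; rewrite mnmDE mnm1E eq_sym (negPf i0) addn0.
by move=> l dl; apply: dmax; rewrite mnmDE addn_gt0 dl.
Qed.

Lemma pommaret_divides_refl s : pommaret_divides s s.
Proof. by exists 0%MM; split=> [|i j []]; rewrite ?add0m ?mnm0E. Qed.

(* A Pommaret divisor of b and b * x_0 itself would both divide b * x_0 ^ j for
   all j, so uniqueness would force all of these powers into the finite P. *)
Lemma pommaret_basis_x0_minimal J P b :
  is_pommaret_basis J P -> J 'X_[b] -> (b + U_(ord0))%MM \notin P.
Proof.
case=> eJ uP Jb; apply/negP => bP.
have [_ _ JM] : is_ideal J := eq_set_ideal eJ (gen_ideal_is_ideal _).
have [s [sP sb]] : exists s, s \in P /\ pommaret_divides s b.
  have [bP'|bP'] := boolP (b \in P).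
    by exists b; split=> //; apply: pommaret_divides_refl.
  by have [s [hs _]] := uP b Jb bP'; exists s.
pose c j := (b + U_(ord0) *+ j)%MM.
have cS j : c j.+1 = (c j + U_(ord0))%MM.
  by rewrite /c mulmSr addmA.
have sc j : pommaret_divides s (c j).
  elim: j => [|j IHj]; first by rewrite /c mulm0n addm0.
  by rewrite cS; apply: pommaret_dividesDx0.
have cP j : c j.+1 \in P.
  elim: j => [|j IHj]; first by rewrite /c mulm1n.
  have [//|cP'] := boolP (c j.+2 \in P).
  have Jc : J 'X_[c j.+2] by rewrite /c addmC mpolyXD; apply: JM.
  have [u [_ uu]] := uP _ Jc cP'.
  have us := uu s (conj sP (sc _)).
  have uc : u = c j.+1.
    apply: uu; split=> //; rewrite (cS j.+1).
    exact/pommaret_dividesDx0/pommaret_divides_refl.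
  (* The equality [s = c j.+1] is impossible by degree, since [s] divides [b]. *)
  have [d [bE _]] := sb.
  have := congr1 mdeg bE; rewrite -us uc /c !mdegD mdegMn mdeg1 mul1n.
  by move/eqP; rewrite addnCA -{1}[mdeg b]addn0 eqn_add2l addnS.
have := cP (\max_(a <- P) mdeg a).
set M := \max_(a <- P) _ => cM.
have : (mdeg (c M.+1) <= M)%N by apply: (leq_bigmax_seq (F := mdeg)).
by rewrite /c mdegD mdegMn mdeg1 mul1n addnS ltnNge leq_addl.
Qed.

(** If x_0^k were in [J], quasi-stability applied to the term 1 would put a power of every variable
    in [J]. A prime containing [J] then contains all variables, and nothing proper lies strictly
    above it. *)
Lemma krull_dim_quot_gt0_x0 J k : quasi_stable J -> krull_dim_quot_gt J 0 ->
  ~ J ('X_ord0 ^+ k).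
Proof.
move=> qJ [l [c [l_gt0 pc sc]]] Jx.
have [prc0 Jc0] := pc 0%N isT.
have [[c00 c0D c0M] c01 c0P] := prc0.
have [[[_ c1D c1M] c11 _] _] := pc 1%N l_gt0.
have [c01s [f c1f c0f]] := sc 0%N l_gt0.
have x_c0 (i : 'I_n.+1) : c 0%N 'X_i.
  have [|s Js] := @quasi_stable_colon_x0 J 0%MM k i qJ.
    by rewrite add0m -mpolyXn.
  move/Jc0: Js; rewrite add0m -mpolyXn; elim: s => [|s IHs].
    by rewrite expr0 => /c01.
  by rewrite exprS => /c0P[].
have c0term b : b != 0%MM -> c 0%N 'X_[b].
  move=> b0; have [i bi] : exists i, b i != 0%N.
    apply/existsP; apply: contraR b0; rewrite negb_exists => /forallP h0.
    by apply/eqP/mnmP => i; rewrite mnm0E; apply/eqP; rewrite -[_ == _]negbK.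
  have -> : b = (b - U_(i) + U_(i))%MM.
    apply/mnmP=> j; rewrite mnmDE mnmBE mnm1E; case: eqP => [<-|_].
      by rewrite subnK // lt0n.
    by rewrite subn0 addn0.
  by rewrite mpolyXD; apply: c0M.
have c0diff : c 0%N (f - (f@_0)%:MP).
  rewrite [X in c 0%N X]mpolyE.
  apply: (big_ind (c 0%N)) => // b _.
  have [->|b0] := eqVneq b 0%MM.
    by rewrite mcoeffB mcoeffC eqxx mulr1 subrr scale0r.
  by rewrite -mul_mpolyC; apply/c0M/c0term.
have f0 : f@_0 != 0.
  by apply/eqP => f0; apply: c0f; move: c0diff; rewrite f0 mpolyC0 subr0.
(* Both [f] and its nonconstant part lie in [c 1], hence so does the unit [f@_0]. *)
apply: c11; have -> : 1 = (f@_0)^-1%:MP * (f + (-1) * (f - (f@_0)%:MP)) :> R.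
  by rewrite mulN1r opprB addrCA subrr addr0 -mpolyCM mulVf.
by apply/c1M/c1D => //; apply/c1M/c01s.
Qed.

End QuasiStable.

(** * Multiplication by powers of x_0, and marked ideals in lowest degree *)

Section MarkedBasis.
Variables (K : fieldType) (n : nat).
Local Notation R := {mpoly K[n.+1]}.
Local Notation X0 := ('X_ord0 : R).
Implicit Types (p q f : R) (I : R -> Prop) (b : 'X_{1..n.+1}).

Lemma mcoeff_x0_exp k f b : (X0 ^+ k * f)@_(b + U_(ord0) *+ k) = f@_b.
Proof. by rewrite mulrC mpolyXn addmC mcoeffMX. Qed.

Lemma mcoeff_x0_exp_small k f b : (b ord0 < k)%N -> (X0 ^+ k * f)@_b = 0.
Proof.
move=> lt_bk; apply/eqP; rewrite mcoeff_eq0 mulrC mpolyXn.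
rewrite (perm_mem (msuppMX _ _)); apply: contraTN lt_bk => /mapP[b' _ ->].
by rewrite -leqNgt mnmDE mulmnE mnm1E eqxx mul1n leq_addr.
Qed.

Lemma x0_part_x0_exp k f : x0_part k (X0 ^+ k * f) = X0 ^+ k * f.
Proof.
apply/mpolyP => b; rewrite mcoeff_x0_part.
by case: leqP => // /mcoeff_x0_exp_small ->.
Qed.

Lemma x0_part_is_linear k : linear (@x0_part K n k).
Proof.
move=> c p q; apply/mpolyP => b.
rewrite mcoeffD mcoeffZ !mcoeff_x0_part mcoeffD mcoeffZ.
by case: ifP => // _; rewrite mulr0 addr0.
Qed.

HB.instance Definition _ k :=
  GRing.isLinear.Build K R R *:%R (@x0_part K n k) (x0_part_is_linear k).

Lemma x0_restE k p : x0_rest k p = p - x0_part k p.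
Proof. by rewrite {2}(x0_part_rest k p) addrC addKr. Qed.

Lemma x0_exp_inj k p q : X0 ^+ k * p = X0 ^+ k * q -> p = q.
Proof. by move=> e; apply/mpolyP => b; rewrite -(mcoeff_x0_exp k) e mcoeff_x0_exp. Qed.

(** For [d < k] the hypothesis forces [f = 0], so the truncated difference is harmless. *)
Lemma dhomog_x0_exp k (d : nat) f :
  X0 ^+ k * f \is d.-homog -> f \is (d - k).-homog.
Proof.
move=> hf; apply/dhomogP => b; rewrite mcoeff_msupp -(mcoeff_x0_exp k).
rewrite -mcoeff_msupp => /(dhomog_mf hf) /=; rewrite mdegD mdegMn mdeg1 mul1n.
by move<-; rewrite addnK.
Qed.

Lemma x0_exp_dhomog k : X0 ^+ k \is k.-homog.
Proof. by rewrite mpolyXn dhomogX /= mdegMn mdeg1 mul1n. Qed.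

Lemma big_divisible_heads (P : {fset 'X_{1..n.+1}}) (Q : pred 'X_{1..n.+1})
    (F : 'X_{1..n.+1} -> R) :
  \sum_(a <- divisible_heads P | Q a) F a =
  \sum_(a <- P | (0 < a ord0)%N && Q a) F a.
Proof.
rewrite -big_filter_cond; apply: perm_big; apply: uniq_perm.
- exact: fset_uniq.
- by rewrite filter_uniq ?fset_uniq.
- by move=> a; rewrite mem_filter !inE andbC.
Qed.

Lemma colon_x0_inf_subspace I : is_ideal I -> is_subspace (colon_x0_inf I).
Proof.
move=> iI; have [I0 ID IM] := iI; have [_ _ IZ] := ideal_subspace iI; split.
- by exists 0%N; rewrite mulr0.
- move=> f g [k If] [l Ig]; exists (l + k)%N; rewrite mulrDr; apply: ID.
    by rewrite exprD -mulrA; apply: IM.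
  by rewrite addnC exprD -mulrA; apply: IM.
- by move=> c f [k If]; exists k; rewrite -scalerAr; apply: IZ.
Qed.

Lemma colon_x0_inf_graded I : is_graded I -> is_graded (colon_x0_inf I).
Proof.
move=> gI f t [k If]; exists k; have := gI _ (t + k)%N If.
by rewrite mulrC (pihomogMr _ _ (x0_exp_dhomog k)) leq_addl addnK mulrC.
Qed.

(** No generator has degree below [d], so in degree [d] only generators of degree exactly [d] with
    constant cofactors survive. *)
Lemma marked_ideal_lowest_degree (J : R -> Prop) P h (d : nat) f :
  is_marked_set J P h -> (forall a, a \in P -> (d <= mdeg a)%N) ->
  gen_ideal (marked_polys P h) f ->
  exists c : 'X_{1..n.+1} -> K,
    pihomog mdeg d f = \sum_(a <- P | mdeg a == d) c a *: h a.
Proof.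
move=> mh dP [k [p [g [hg ->]]]].
rewrite raddf_sum /=.
pose Q f := exists c : 'X_{1..n.+1} -> K,
    f = \sum_(a <- P | mdeg a == d) c a *: h a.
have Q0 : Q 0 by exists (fun=> 0); rewrite big1 // => a _; rewrite scale0r.
apply: (big_ind Q) => // [_ _ [c1 ->] [c2 ->]|i _].
  exists (fun a => c1 a + c2 a); rewrite -big_split.
  by apply: eq_bigr => a _; rewrite scalerDl.
have [a aP ->] := hg i.
rewrite (pihomogMr _ _ (marked_set_dhomog mh aP)).
case: leqP => // le_ad; have da : mdeg a = d.
  by apply/eqP; rewrite eqn_leq le_ad dP.
(* The cofactor contributes its component of degree [d - mdeg a = 0], its constant term. *)
exists (fun a' => if a' == a then (p i)@_0 else 0).
rewrite (big_rem a) //= da !eqxx subnn pihomog0E mul_mpolyC.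
rewrite big_seq_cond big1 ?addr0 // => a' /andP[].
by rewrite mem_rem_uniq ?fset_uniq // inE => /andP[/negPf-> _]; rewrite scale0r.
Qed.

End MarkedBasis.

(** * Comparison of the colon ideal with [I] and the syzygy quotients, where [d] stands for m - 1 *)

Section SyzygyQuotients.
Variables (K : fieldType) (n : nat).
Local Notation R := {mpoly K[n.+1]}.
Local Notation X0 := ('X_ord0 : R).
Variables (J I : R -> Prop) (d : nat) (P : {fset 'X_{1..n.+1}}).
Variable h : 'X_{1..n.+1} -> R.
Hypothesis J_quasi_stable : quasi_stable J.
Hypothesis dim_pos : krull_dim_quot_gt J 0.
Hypothesis J_truncation : eq_set J (truncation (saturation J) d).
Hypothesis P_pommaret : is_pommaret_basis J P.
Hypothesis h_marked_basis : is_marked_basis J P h.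
Hypothesis I_generated : eq_set I (gen_ideal (marked_polys P h)).

Let I_ideal : is_ideal I :=
  eq_set_ideal I_generated (gen_ideal_is_ideal _).

Lemma pommaret_basis_sub a : a \in P -> J 'X_[a].
Proof.
case: P_pommaret => eJ _ aP.
by apply/eJ/gen_ideal_mem; exists a.
Qed.

Lemma pommaret_basis_mdeg a : a \in P -> (d <= mdeg a)%N.
Proof.
move=> /pommaret_basis_sub/J_truncation Ja; rewrite leqNgt; apply/negP.
by move=> /(truncation_coeff Ja)/eqP; rewrite mcoeffX eqxx oner_eq0.
Qed.

(** Were the degree larger, [a] divided by x_0 would still have degree at least [d] and so lie in
    [J], which [pommaret_basis_x0_minimal] excludes. *)
Lemma divisible_head_mdeg a : a \in P -> (0 < a ord0)%N -> mdeg a = d.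
Proof.
move=> aP a0; apply/eqP; rewrite eqn_leq pommaret_basis_mdeg // andbT leqNgt.
apply/negP => lt_da; pose b := (a - U_(ord0))%MM.
have ab : a = (b + U_(ord0))%MM.
  by rewrite submK //; apply/mnm_lepP => i; rewrite mnm1E; case: eqP => // <-.
have: (b + U_(ord0))%MM \notin P.
  apply: (pommaret_basis_x0_minimal P_pommaret).
  apply: (@saturated_truncation_colon _ _ _ d b 1) => //.
    by move: lt_da; rewrite ab mdegD mdeg1 addn1.
  by rewrite mulm1n -ab; apply: pommaret_basis_sub.
by rewrite -ab aP.
Qed.

(** Since the rests cancel they can be added back: x_0^k [f] is the combination of the whole [h a],
    all of degree [d]. *)
Lemma syzygy_quotientsP m f : syzygy_quotients P h m f ->
  exists k : nat, [/\ (1 <= k <= m - 2)%N, I (X0 ^+ k * f) & f \is (d - k).-homog].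
Proof.
case=> k [c [hk rest0 ->]]; exists k.
have [mh _] := h_marked_basis; have [_ _ IZ] := ideal_subspace I_ideal.
set f' := \sum_(a <- _ | _) _.
have fE : X0 ^+ k * f' =
    \sum_(a <- divisible_heads P | (k <= a ord0)%N) c a *: h a.
  rewrite /f' mulr_sumr -[LHS]addr0 -[X in _ + X]rest0 -big_split /=.
  apply: eq_bigr => a _; rewrite -scalerAr -scalerDr mulrC x0_quot_part.
  by rewrite -x0_part_rest.
split=> //.
  rewrite fE big_seq_cond; apply: subspace_sum => [|a].
    exact: ideal_subspace.
  rewrite !inE /= => /andP[/andP[aP _] _]; apply/IZ/I_generated/gen_ideal_mem.
  by exists a.
apply: dhomog_x0_exp; rewrite fE big_seq_cond; apply: rpred_sum => a.
rewrite !inE /= => /andP[/andP[aP a0] _]; apply: rpredZ.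
by rewrite -(divisible_head_mdeg aP a0); apply: marked_set_dhomog mh aP.
Qed.

(* The normal form r of f satisfies x_0 ^ k r \in I for some k, and x_0 ^ k r is
   still a combination of normal terms since J is saturated in degrees >= d. *)
Lemma colon_x0_inf_high_degree f (t : nat) :
  (d <= t)%N -> f \is t.-homog -> colon_x0_inf I f -> I f.
Proof.
move=> le_dt hf [k Ikf]; have [mh dsum] := h_marked_basis.
have [I0 ID IM] := I_ideal.
have [/(_ f)[/(_ hf)[g [r [[/I_generated Ig _] hr fE]]] _] _] := dsum t.
have Ikr : I (X0 ^+ k * r).
  have -> : r = f + (-1) * g by rewrite fE mulN1r addrAC subrr add0r.
  by rewrite mulrDr; apply: ID => //; apply/IM/IM.
have [hom_kr normal_kr] :
    X0 ^+ k * r \is (t + k).-homog /\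
    linear_span (terms (fun b => normal_term J b /\ mdeg b = (t + k)%N))
      (X0 ^+ k * r).
  case: hr => l [c [u [hu ->]]]; rewrite mulr_sumr.
  split; [apply: rpred_sum => i _ | apply: subspace_sum => [|i _]].
  - have [b [_ bt] ->] := hu i; rewrite -scalerAr rpredZ //.
    by rewrite mpolyXn -mpolyXD dhomogX /= mdegD mdegMn mdeg1 mul1n bt addnC.
  - exact: linear_span_subspace.
  have [b [nb bt] ->] := hu i; rewrite -scalerAr.
  have [_ _] := linear_span_subspace
    (terms (fun b => normal_term J b /\ mdeg b = (t + k)%N)) (K := K).
  apply; apply: linear_span_mem; exists (b + U_(ord0) *+ k)%MM.
    split; last by rewrite mdegD mdegMn mdeg1 mul1n bt.
    move=> Jbk; apply: nb.
    by apply: (saturated_truncation_colon _ J_truncation _ Jbk); rewrite ?bt.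
  by rewrite addmC mpolyXD mpolyXn.
(* This product lies in both summands of the decomposition in degree [t + k]. *)
have kr0 : X0 ^+ k * r = 0.
  have [_] := dsum (t + k)%N; apply=> //; split=> //; exact/I_generated.
have r0 : r = 0 by apply: (@x0_exp_inj _ _ k); rewrite kr0 mulr0.
by rewrite fE r0 addr0.
Qed.

Lemma colon_x0_inf_low_degree f (t : nat) :
  (t < d)%N -> f \is t.-homog -> colon_x0_inf I f ->
  f = 0 \/ syzygy_quotients P h d.+1 f.
Proof.
move=> lt_td hf [k Ikf]; have [mh _] := h_marked_basis.
have [->|f_neq0] := eqVneq f 0; [by left | right].
have [I0 ID IM] := I_ideal.
pose j := (d - t)%N; have jt : (j + t)%N = d by rewrite subnK // ltnW.
have j_gt0 : (0 < j)%N by rewrite subn_gt0.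
have hjf : X0 ^+ j * f \is d.-homog.
  by rewrite -jt; apply: dhomogM => //; apply: x0_exp_dhomog.
have Ijf : I (X0 ^+ j * f).
  apply: (colon_x0_inf_high_degree (leqnn d) hjf); exists k.
  by rewrite mulrCA; apply: IM.
have [c] := marked_ideal_lowest_degree mh pommaret_basis_mdeg
  (iffLR (I_generated _) Ijf).
rewrite pihomog_dE // => fE.
(* A head is in [J], so it cannot occur in the tail of another marked polynomial. *)
have cE a : a \in P -> mdeg a = d -> (X0 ^+ j * f)@_a = c a.
  move=> aP da; have [_ haa _] := mh a aP.
  rewrite fE raddf_sum /= (big_rem a) //= da eqxx mcoeffZ haa mulr1.
  rewrite big_seq_cond big1 ?addr0 // => a' /andP[].
  rewrite mem_rem_uniq ?fset_uniq // inE => /andP[ne_a a'P] _.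
  rewrite mcoeffZ; have [_ _ tail] := mh a' a'P.
  have [ha'|] := boolP (a \in msupp (h a')); last first.
    by rewrite -mcoeff_eq0 => /eqP->; rewrite mulr0.
  have := tail a ha'; rewrite eq_sym ne_a => /(_ isT)[].
  exact: pommaret_basis_sub.
have {fE} fE : X0 ^+ j * f =
    \sum_(a <- divisible_heads P | (j <= a ord0)%N) c a *: h a.
  (* The index sets differ only by heads of degree [d] not divisible by x_0^j, where [c a] is a
     coefficient of a multiple of x_0^j and vanishes. *)
  rewrite big_divisible_heads fE big_mkcond [RHS]big_mkcond /=.
  apply: eq_big_seq => a aP; case: eqP => [da|ne_da]; last first.
    by case: ifP => // /andP[a0 _]; have := divisible_head_mdeg aP a0.
  case: (leqP j (a ord0)) => [le_ja|lt_aj]; first by rewrite (leq_trans j_gt0 le_ja).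
  by rewrite andbF -cE // mcoeff_x0_exp_small // scale0r.
have part_E : X0 ^+ j * f = \sum_(a <- divisible_heads P | (j <= a ord0)%N)
    c a *: x0_part j (h a).
  rewrite -[LHS]x0_part_x0_exp fE raddf_sum.
  by apply: eq_bigr => a _; rewrite /= linearZ.
exists j, c; split.
(* The bound [j <= d - 1] amounts to [t != 0]. For [t = 0], a contributing head would have degree
   [d] and be divisible by x_0^d, so x_0^d would lie in [J]; hence the sum is empty and [f = 0]. *)
- rewrite j_gt0 subSS subn1 -ltnS (ltn_predK lt_td) ltn_subrL.
  rewrite (leq_ltn_trans _ lt_td) // andbT lt0n; apply: contra_neq f_neq0 => t0.
  apply: (@x0_exp_inj _ _ j); rewrite mulr0 fE big_divisible_heads.
  rewrite big_seq_cond big1 // => a /andP[aP /andP[a0 le_ja]].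
  have [] := krull_dim_quot_gt0_x0 (k := d) J_quasi_stable dim_pos.
  have da := divisible_head_mdeg aP a0.
  have le_da : (U_(ord0) *+ d <= a)%MM.
    apply/mnm_lepP => i; rewrite mulmnE mnm1E.
    by case: eqP => // <-; rewrite mul1n -{1}jt t0 addn0.
  rewrite mpolyXn; suff <- : a = (U_(ord0) *+ d)%MM by apply: pommaret_basis_sub.
  rewrite -(submK le_da) -[RHS]add0m; congr (_ + _)%MM; apply/eqP.
  have := congr1 mdeg (submK le_da); rewrite mdegD da mdegMn mdeg1 mul1n.
  by rewrite -[RHS]add0n => /eqP; rewrite eqn_add2r mdeg_eq0.
(* The full sum and the sum of the divisible parts both equal x_0^j [f], so the rests cancel. *)
- under eq_bigr do rewrite x0_restE scalerBr.
  by rewrite sumrB -part_E -fE subrr.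
- apply: (@x0_exp_inj _ _ j); rewrite part_E mulr_sumr.
  by apply: eq_bigr => a _; rewrite -scalerAr mulrC x0_quot_part.
Qed.

End SyzygyQuotients.

(** * Assembly of the graded decomposition *)

Theorem theorem4p5 (K : fieldType) (n : nat)
    (J : {mpoly K[n.+1]} -> Prop)
    (J_quasi_stable : quasi_stable J)
    (dim_pos : krull_dim_quot_gt J 0)
    (rho : nat)
    (rho_satiety : is_satiety (image_mod_x0 (add_x0 (saturation J))) rho)
    (I : {mpoly K[n.+1]} -> Prop)
    (I_homogeneous : is_homogeneous_ideal I)
    (m : nat) (rho_le_m : (rho <= m)%N)
    (J_truncation : eq_set J (truncation (saturation J) (m - 1)))
    (I_truncation : eq_set I (truncation (saturation I) (m - 1)))
    (P : {fset 'X_{1..n.+1}}) (P_pommaret : is_pommaret_basis J P)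
    (h : 'X_{1..n.+1} -> {mpoly K[n.+1]})
    (h_marked_basis : is_marked_basis J P h)
    (I_generated : eq_set I (gen_ideal (marked_polys P h))) :
  graded_direct_sum (colon_x0_inf I) I (linear_span (syzygy_quotients P h m)).
Proof.
have [I_ideal I_graded] := I_homogeneous.
have [I0 ID IM] := I_ideal.
have I_subspace := ideal_subspace I_ideal.
have C_subspace := colon_x0_inf_subspace I_ideal.
have C_graded := colon_x0_inf_graded I_graded.
set S := syzygy_quotients P h m.
have SP f : S f -> exists k : nat,
    [/\ (1 <= k <= m - 2)%N, I ('X_ord0 ^+ k * f) & f \is (m - 1 - k).-homog].
  exact: (syzygy_quotientsP J_quasi_stable J_truncation P_pommaret
            h_marked_basis I_generated).
have S_subspace := linear_span_subspace S.
have [S0 SD SZ] := S_subspace.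
have S_colon : forall f, linear_span S f -> colon_x0_inf I f.
  apply: linear_span_min => // f /SP[k [_ Ikf _]]; by exists k.
have S_graded : is_graded (linear_span S).
  move=> f t; move: f; apply: linear_span_min => [|f Sf].
    split=> [|f g|c f]; rewrite ?linear0 ?linearD ?linearZ //=.
      exact: SD.
    exact: SZ.
  have [k [_ _ hf]] := SP f Sf; have [<-|ne_t] := eqVneq (m - 1 - k)%N t.
    by rewrite pihomog_dE //; apply: linear_span_mem.
  by rewrite (pihomog_ne0 ne_t hf).
have S_high f b : linear_span S f -> (m - 1 <= mdeg b)%N -> f@_b = 0.
  move=> Sf le_mb; move: f Sf; apply: linear_span_min => [|f /SP].
    split=> [|f g f0 g0|c f f0]; rewrite ?mcoeff0 ?mcoeffD ?mcoeffZ ?f0 ?g0 //.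
      by rewrite addr0.
    by rewrite mulr0.
  case=> k [/andP[k_gt0 le_km] _ hf]; apply: (dhomog_nemf_coeff hf).
  rewrite neq_ltn orbC (leq_trans _ le_mb) // ltn_subrL k_gt0 /=.
  (* For [m <= 1] the truncated [m - 2] is 0, leaving no admissible [k]. *)
  case: (m) le_km => [|[|m']]; rewrite ?subn1 //= => le_k0.
    by rewrite leqn0 in le_k0; rewrite (eqP le_k0) in k_gt0.
  by rewrite leqn0 in le_k0; rewrite (eqP le_k0) in k_gt0.
split; [by split | by split | by split | split].
  move=> f; split; last first.
    case=> g [s [Ig Ss ->]]; have [_ CD _] := C_subspace; apply: CD.
      by exists 0%N; rewrite expr0 mul1r.
    exact: S_colon.
  move=> Cf; apply: (@graded_subspace_sum _ _
    (fun f => exists g s, [/\ I g, linear_span S s & f = g + s])) => [|t].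
    split.
    - by exists 0, 0; split; rewrite ?addr0.
    - move=> _ _ [g1 [s1 [Ig1 Ss1 ->]]] [g2 [s2 [Ig2 Ss2 ->]]].
      by exists (g1 + g2), (s1 + s2); split; [exact: ID|exact: SD|rewrite addrACA].
    - move=> c _ [g [s [Ig Ss ->]]]; have [_ _ IZ] := I_subspace.
      by exists (c *: g), (c *: s); split; [exact: IZ|exact: SZ|rewrite scalerDr].
  have Cft := C_graded f t Cf; have hft := pihomogP mdeg t f.
  have [le_mt|lt_tm] := leqP (m - 1) t.
    exists (pihomog mdeg t f), 0; split; rewrite ?addr0 //.
    exact: (colon_x0_inf_high_degree J_quasi_stable J_truncation
              h_marked_basis I_generated le_mt).
  exists 0, (pihomog mdeg t f); split; rewrite ?add0r //.
  (* The case [m = 0] cannot occur here, as no [t] lies below 0. *)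
  have mE : (m - 1).+1 = m by case: (m) lt_tm => // m' _; rewrite subn1.
  have := colon_x0_inf_low_degree J_quasi_stable dim_pos J_truncation
    P_pommaret h_marked_basis I_generated lt_tm hft Cft.
  by rewrite mE => -[-> //|]; apply: linear_span_mem.
(* The intersection is zero because the two summands have no degree in common. *)
move=> f /I_truncation If Sf; apply/mpolyP => b; rewrite mcoeff0.
by have [/(S_high f b Sf)|/(truncation_coeff If)] := leqP (m - 1) (mdeg b).
Qed.
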